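(* Let $X_\Omega$ be a four-dimensional convex toric domain, let $k\in\mathbb{Z}_{\ge1}$, and assume that $\Omega$ has sides of length $a,b$ along the $x$ and $y$ axes respectively, with $a\ge b$. Consider the minimization problem $$\tilde{\mathfrak g}_k(X_\Omega)=\min\sum_{s=1}^q\|(i_s,j_s)\|_\Omega^*$$ over all $q\ge1$ and all $(i_1,j_1),\dots,(i_q,j_q)\in\mathbb{Z}_{\ge0}^2\setminus\{(0,0)\}$ such that $\sum_{s=1}^q(i_s+j_s)+q-1=k$ and such that, if $q\ge2$, then $(i_1,\dots,i_q)\ne(0,\dots,0)$ and $(j_1,\dots,j_q)\ne(0,\dots,0)$. Then there is a minimizer $(i_1,j_1),\dots,(i_q,j_q)$ taking one of the following forms: (i) $(0,1)^{\times i}\times(1,1)^{\times j}$ for $i\ge0$, $j\ge1$; (ii) $(0,1)^{\times i}\times(1,s)$ for $i\ge0$ and $s\ge2$; (iii) $(0,1)^{\times i}\times(1,0)$ for $i\ge1$; (iv) $(0,s)$ for $s\ge1$.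
   Context: **Convex toric domains.** A four-dimensional convex toric domain is $X_\Omega=\mu^{-1}(\Omega)\subset\mathbb{C}^2$, where $\mu(z_1,z_2)=(\pi|z_1|^2,\pi|z_2|^2)$ and $\Omega\subset\mathbb{R}^2_{\ge0}$ is a subdomain (nonempty interior) such that $\{(x_1,x_2)\in\mathbb{R}^2:(|x_1|,|x_2|)\in\Omega\}$ is compact and convex; it carries the standard symplectic form. For $\vec v\in\mathbb{R}^2$, $\|\vec v\|_\Omega^*:=\max_{\vec w\in\Omega}\langle\vec v,\vec w\rangle$. ''Sides of length $a,b$'' means $a=\max\{x:(x,0)\in\Omega\}$ and $b=\max\{y:(0,y)\in\Omega\}$. Notation such as $(0,1)^{\times i}\times(1,1)^{\times j}$ denotes the tuple consisting of $i$ copies of $(0,1)$ and $j$ copies of $(1,1)$. **The capacity $\tilde{\mathfrak g}_k$.** A Liouville domain is a compact $2n$-dimensional manifold with boundary $X$ with a one-form $\lambda$ such that $\omega=d\lambda$ is symplectic and $\alpha=\lambda|_{\partial X}$ is a positive contact form; it has nondegenerate contact boundary if all Reeb orbits of $\alpha$ are nondegenerate. The action of a Reeb orbit is its period, and $\mathcal A_{\partial X}(\Gamma)$ is the sum of the actions of a tuple $\Gamma$. The completion is $\widehat X=X\cup([0,\infty)_r\times\partial X)$ with its natural symplectic form. For a point $p\in\mathrm{Int}\,X$ and a local smooth codimension two symplectic submanifold $D$ through $p$ (local divisor), $\mathcal J(X;D)$ is the set of compatible almost complex structures on $\widehat X$ which, on the cylindrical end, are $r$-translation invariant, map $\partial_r$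 to the Reeb vector field and restrict to compatible almost complex structures on the contact hyperplanes, and which are integrable near $p$ and preserve the germ of $D$ at $p$. For a tuple $\Gamma$ of Reeb orbits, $\mathcal M^J_X(\Gamma)\langle\langle\mathcal T^{(m)}p\rangle\rangle$ is the moduli space of asymptotically cylindrical $J$-holomorphic punctured spheres in $\widehat X$ with positive punctures asymptotic to $\Gamma$ and with a marked point mapping to $p$ with contact order at least $m$ to $D$. For $X$ a Liouville domain with nondegenerate contact boundary, $$\tilde{\mathfrak g}_k(X)=\sup_{J\in\mathcal J(X;D)}\ \inf_{\Gamma_1,\dots,\Gamma_a}\ \sum_{i=1}^a\mathcal A_{\partial X}(\Gamma_i),$$ the infimum being over all $a\ge1$ and tuples $\Gamma_1,\dots,\Gamma_a$ of Reeb orbits such that for some positive integers $k_1,\dots,k_a$ with $\sum k_i\ge k$ every $\mathcal M^J_X(\Gamma_i)\langle\langle\mathcal T^{(k_i)}p\rangle\rangle$ contains a nonconstant curve. (This does not depend on $p,D$.) For an arbitrary symplectic manifold $M$ (boundary or corners allowed), $\tilde{\mathfrak g}_k(M)=\sup_X\tilde{\mathfrak g}_k(X)$ over all Liouville domains $X$ with nondegenerate contact boundary admitting an equidimensional symplectic embedding into $M$; the two definitions are consistent. *)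

(* Defs.v *)
From HB Require Import structures.
From mathcomp Require Import all_boot all_order all_algebra.
From mathcomp Require Import all_classical all_reals all_analysis.

Set Implicit Arguments.
Unset Strict Implicit.
Unset Printing Implicit Defensive.

Import Order.TTheory GRing.Theory Num.Theory.
Import numFieldNormedType.Exports.
Local Open Scope classical_set_scope.
Local Open Scope ring_scope.

Definition symmetrization (R : realType) (Omega : set (R * R)) : set (R * R) :=
  [set x | Omega (`|x.1|, `|x.2|)].

(** [Omega] is the moment image of a four-dimensional convex toric domain
    [X_Omega], the preimage of [Omega] under
    [(z1, z2) |-> (pi |z1|^2, pi |z2|^2)].  [X_Omega] and [Omega] determine
    each other, so only [Omega] appears. *)
Definition convex_toric (R : realType) (Omega : set (R * R)) : Prop :=
  [/\ Omega `<=` [set x | 0 <= x.1 /\ 0 <= x.2],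
      interior Omega !=set0,
      compact (symmetrization Omega) &
      @convex_set R (R^o * R^o)%type (symmetrization Omega)].

Definition is_max (R : realType) (A : set R) (m : R) : Prop :=
  A m /\ ubound A m.

(** [||v||_Omega^*]; the supremum is a maximum for convex toric [Omega], see
    [dual_norm_is_max]. *)
Definition dual_norm (R : realType) (Omega : set (R * R)) (v : R * R) : R :=
  sup [set v.1 * w.1 + v.2 * w.2 | w in Omega].

Definition cost (R : realType) (Omega : set (R * R)) (s : seq (nat * nat)) : R :=
  \sum_(v <- s) dual_norm Omega (v.1%:R, v.2%:R).

(** The tuple [(i_1, j_1), ..., (i_q, j_q)] is the list [s], with
    [q = size s]; as [q >= 1], the truncated [(size s).-1] is [q - 1]. *)
Definition admissible (k : nat) (s : seq (nat * nat)) : Prop :=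
  [/\ (1 <= size s)%N,
      forall v, v \in s -> v <> (0, 0)%N,
      (\sum_(v <- s) (v.1 + v.2) + (size s).-1)%N = k &
      (2 <= size s)%N ->
        (exists2 v, v \in s & v.1 <> 0%N) /\ (exists2 v, v \in s & v.2 <> 0%N)].

Definition minimizer (R : realType) (Omega : set (R * R)) (k : nat)
    (s : seq (nat * nat)) : Prop :=
  admissible k s /\ forall t, admissible k t -> cost Omega s <= cost Omega t.

Lemma dual_norm_is_max (R : realType) (Omega : set (R * R)) (v : R * R) :
  convex_toric Omega ->
  is_max [set v.1 * w.1 + v.2 * w.2 | w in Omega] (dual_norm Omega v).
Proof.
move=> [Oge0 [w0 /interior_subset Ow0] cO _].
pose f (w : R * R) := v.1 * `|w.1| + v.2 * `|w.2|.
have absO w : Omega w -> (`|w.1|, `|w.2|) = w.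
  by case: w => x y /Oge0 /= [x0 y0]; rewrite !ger0_norm.
have cf : continuous f.
  move=> w; apply: cvgD; apply: cvgM; try exact: cvg_cst.
  - by apply: cvg_norm; exact: cvg_fst.
  - by apply: cvg_norm; exact: cvg_snd.
have O0 : symmetrization Omega !=set0.
  by exists w0; rewrite /symmetrization /= absO.
have [c cO' cmax] := compact_EVT_max O0 cO (continuous_subspaceT cf).
have ubc : ubound [set v.1 * w.1 + v.2 * w.2 | w in Omega] (f c).
  move=> _ [w Ow <-]; have aw := absO _ Ow.
  have := cmax w; rewrite inE /symmetrization /= aw => /(_ Ow).
  by have [x0 y0] := Oge0 _ Ow; rewrite {1}/f (ger0_norm x0) (ger0_norm y0).
have Ac : [set v.1 * w.1 + v.2 * w.2 | w in Omega] (f c).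
  by move: cO'; rewrite inE => cO'; exists (`|c.1|, `|c.2|).
suff -> : dual_norm Omega v = f c by split.
apply/eqP; rewrite eq_le; apply/andP; split.
  by apply: ge_sup ubc; exists (f c).
by apply: ub_le_sup => //; exists (f c).
Qed.

(* Main.v *)
(* A tuple satisfies the index constraint iff its weight, the sum of the
   [i_s + j_s + 1], is [k + 1], so any piece of it may be traded for another of
   the same weight and no larger cost.  If some [i_s] is positive, such trades
   turn every vector into copies of (0,1) and vectors (1,s): for [i >= 2] this
   uses [i ||(1,s)|| <= ||(i,j)||] for [s i <= j] and [j ||(0,1)|| <= ||(i,j)||],
   whose convex combinations dominate the cost of the replacement.  Since
   [s ||(0,1)|| <= ||(1,s)||] and [||(1,s+1)|| <= ||(1,s)|| + ||(0,1)||], two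
   vectors (1,s), (1,t) can again be traded for fewer of them unless
   [s = t = 1].  Only finitely many tuples of the resulting shape exist, which
   also yields the existence of the minimum. *)
Require Import Defs.
From mathcomp Require Import all_boot all_order all_algebra.
From mathcomp Require Import all_classical all_reals all_analysis.
From mathcomp Require Import zify lra.

Import Order.TTheory GRing.Theory Num.Theory.
Local Open Scope classical_set_scope.
Local Open Scope ring_scope.

(** * Trades for an abstract system of costs *)

(* [b] plays the role of the cost of (0, 1), and [c s] that of the cost of
   (1, s). *)
Record column_costs {R : realType} (b : R) (c : nat -> R) : Prop :=
  ColumnCosts {
    column_unit_ge0 : 0 <= b;
    column_unit_le : b <= c 0%N;
    column_ge : forall s, s%:R * b <= c s;
    column_step : forall s, c s.+1 <= c s + b }.
Arguments column_unit_ge0 {R b c}.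
Arguments column_unit_le {R b c}.
Arguments column_ge {R b c}.
Arguments column_step {R b c}.

(* The weight of a tuple is the sum of the [i + j + 1]; weight [k + 1] encodes
   the index constraint.  The two cases stand for the tuples
   [(0,1)^i x (1,1)^j] and [(0,1)^i x (1,s)]. *)
Definition reduced_bound {R : realType} (b : R) (c : nat -> R)
    (W : nat) (C : R) : Prop :=
  (exists i j : nat, [/\ (2 <= j)%N, W = (2 * i + 3 * j)%N &
                         i%:R * b + j%:R * c 1%N <= C]) \/
  (exists i s : nat, W = (2 * i + s + 2)%N /\ i%:R * b + c s <= C).

Lemma reduced_bound_le {R : realType} (b : R) (c : nat -> R) W C C' :
  C <= C' -> reduced_bound b c W C -> reduced_bound b c W C'.
Proof.
move=> CC' [[i [j [j2 -> le_C]]]|[i [s [-> le_C]]]].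
  by left; exists i, j; split=> //; exact: le_trans CC'.
by right; exists i, s; split=> //; exact: le_trans CC'.
Qed.

Lemma reduced_bound_add_units {R : realType} (b : R) (c : nat -> R) W C n :
  reduced_bound b c W C -> reduced_bound b c (W + 2 * n) (C + n%:R * b).
Proof.
case=> [[i [j [j2 -> le_C]]]|[i [s [-> le_C]]]].
  left; exists (i + n)%N, j; split=> //; first by lia.
  by rewrite natrD; lra.
right; exists (i + n)%N, s; split; first by lia.
by rewrite natrD; lra.
Qed.

(** For odd [s], [(0,s)] trades for [(s+1)/2] units [(0,1)]. For even [s] its weight is odd, so it
    is merged with a vector already present. *)
Lemma reduced_bound_add_vertical {R : realType} (b : R) (c : nat -> R) W C s :
  column_costs b c -> (1 <= s)%N ->
  reduced_bound b c W C -> reduced_bound b c (W + s + 1) (C + s%:R * b).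
Proof.
move=> cc s1 rW; have b0 := column_unit_ge0 cc.
have [n [e [en es]]] : exists n e : nat, (e <= 1)%N /\ s = (2 * n + e)%N.
  by exists s./2, (odd s); split; lia.
have sR : s%:R = 2 * n%:R + e%:R :> R by rewrite es natrD natrM.
have e01 : e = 0%N \/ e = 1%N by lia.
case: e01 es sR => -> es sR {e en}; rewrite sR.
  have n1 : 1 <= n%:R :> R by rewrite (ler_nat R 1 n); lia.
  case: rW => [[i [j [j2 -> le_C]]]|[i [t [-> le_C]]]].
    (* (1,1) and (0,2n) together weigh as much as n + 2 copies of (0,1) *)
    have c1 := column_ge cc 1%N.
    case: (ltngtP j 2%N) => [|j3|j2']; first by lia.
      left; exists (i + n + 2)%N, (j - 1)%N; split; [lia|lia|].
      by rewrite natrB; [|lia]; rewrite 2!natrD; nra.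
    right; exists (i + n + 2)%N, 1%N; split; first by lia.
    by move: le_C; rewrite j2' 2!natrD; nra.
  (* [(1,t)] and [(0,2n)] become [(1,t+1)] and [n] units; [n + 1 <= 2n] pays for the step from [t]
     to [t+1]. *)
  right; exists (i + n)%N, t.+1; split; first by lia.
  by have := column_step cc t; rewrite natrD; nra.
have := reduced_bound_add_units b c W C n.+1 rW.
have -> : (W + 2 * n.+1)%N = (W + s + 1)%N by lia.
apply: reduced_bound_le.
by rewrite -natr1; have : 0 <= n%:R :> R by []; nra.
Qed.

Lemma reduced_bound_add_column {R : realType} (b : R) (c : nat -> R) W C s :
  column_costs b c ->
  reduced_bound b c W C -> reduced_bound b c (W + s + 2) (C + c s).
Proof.
move=> cc; have b0 := column_unit_ge0 cc; have cs := column_ge cc s.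
have [n [e [en es]]] : exists n e : nat, (e <= 1)%N /\ s = (2 * n + e)%N.
  by exists s./2, (odd s); split; lia.
have sR : s%:R = 2 * n%:R + e%:R :> R by rewrite es natrD natrM.
have n0 : n = 0%N \/ 1 <= n%:R :> R.
  by case: (n) => [|n']; [left|right; rewrite (ler_nat R 1)].
have c1 := column_ge cc 1%N; have cu := column_unit_le cc.
have e01 : e = 0%N \/ e = 1%N by lia.
rewrite {}sR in cs.
case: e01 es cs => {e en} -> es cs rW.
  (* (1,2n) weighs as much as n + 1 copies of (0,1), which cost no more *)
  have := reduced_bound_add_units b c W C n.+1 rW.
  have -> : (W + 2 * n.+1)%N = (W + s + 2)%N by lia.
  apply: reduced_bound_le; rewrite -natr1.
  by case: n0 => [n0|n1]; [have -> : s = 0%N by lia|]; rewrite ?n0; nra.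
case: n0 => [n0|n1].
  have {es cs n0} -> : s = 1%N by lia.
  case: rW => [[i [j [j2 -> le_C]]]|[i [t [-> le_C]]]].
    left; exists i, j.+1; split; [lia|lia|].
    by rewrite -natr1; lra.
  have ct := column_ge cc t.
  have [m [e [em et]]] : exists m e : nat, (e <= 1)%N /\ t = (2 * m + e)%N.
    by exists t./2, (odd t); split; lia.
  have tR : t%:R = 2 * m%:R + e%:R :> R by rewrite et natrD natrM.
  have m0 : m = 0%N \/ 1 <= m%:R :> R.
    by case: (m) => [|m']; [left|right; rewrite (ler_nat R 1)].
  have e01 : e = 0%N \/ e = 1%N by lia.
  rewrite {}tR in ct.
  case: e01 et ct => {e em} -> et ct.
    (* Here the old column [(1,2m)] dissolves into [m + 1] units, and the new [(1,1)] stays. *)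
    right; exists (i + m + 1)%N, 1%N; split; first by lia.
    rewrite 2!natrD; case: m0 => [m0|m1]; last by nra.
    have et0 : t = 0%N by lia.
    by move: le_C; rewrite et0 m0; lra.
  case: m0 => [m0|m1].
    left; exists i, 2%N; split; [by []|lia|].
    have t1 : t = 1%N by lia.
    by move: le_C; rewrite t1; lra.
  (* [(1,1)] and [(1,2m+1)] become [(1,2)] and [m + 1] units; [m + 2 <= 2m + 1] covers the cost. *)
  right; exists (i + m + 1)%N, 2%N; split; first by lia.
  have c2 := column_step cc 1%N.
  by rewrite 2!natrD; nra.
(* Now [s = 2n + 1 >= 3]. Together with a [(1,1)] it becomes [n + 3] units; with [(1,t)], it becomes
   [(1,t+1)] and [n + 1] units. *)
case: rW => [[i [j [j2 -> le_C]]]|[i [t [-> le_C]]]].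
  case: (ltngtP j 2%N) => [|j3|j2']; first by lia.
    left; exists (i + n + 3)%N, (j - 1)%N; split; [lia|lia|].
    by rewrite natrB; [|lia]; rewrite 2!natrD; nra.
  right; exists (i + n + 3)%N, 1%N; split; first by lia.
  by move: le_C; rewrite j2' 2!natrD; nra.
right; exists (i + n + 1)%N, t.+1; split; first by lia.
by have := column_step cc t; rewrite 2!natrD; nra.
Qed.

(** [C] stands for the norm of [(i,j)]. The replacement is chosen by the parity of [i + j] and the
    size of [j] against [i] and [2i]. *)
Lemma reduced_bound_vector {R : realType} (b : R) (c : nat -> R) i j C :
  column_costs b c -> (1 <= i)%N ->
  (forall s, (s * i <= j)%N -> i%:R * c s <= C) -> j%:R * b <= C ->
  reduced_bound b c (i + j + 1) C.
Proof.
move=> cc i1 iC jC; have b0 := column_unit_ge0 cc.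
case: (ltngtP i 1%N) => [|i2|ii]; first by lia.
  have i0 : 0 < i%:R :> R by rewrite (ltr_nat R 0); lia.
  have aC := iC 0%N (leq0n _); have ba := column_unit_le cc.
  have c1 := column_step cc 0%N.
  (* Convex combination of [i * c s <= C] and [j * b <= C] with coefficients [p/i] and [1 - p/i]. *)
  have average s p r : (s * i <= j)%N -> (p <= i)%N ->
      (i * r <= (i - p) * j)%N -> p%:R * c s + r%:R * b <= C.
    move=> sij pi; rewrite -(ler_nat R) !natrM natrB // => irj.
    have sC := iC s sij; rewrite -(ler_pM2l i0).
    have := ler_wpM2r b0 irj.
    have p0 : 0 <= p%:R :> R by [].
    have pi' : p%:R <= i%:R :> R by rewrite ler_nat.
    have := ler_wpM2l p0 sC.
    have ip0 : 0 <= i%:R - p%:R :> R by lra.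
    by have := ler_wpM2l ip0 jC; lra.
  have [r [e [e1 er]]] : exists r e : nat, (e <= 1)%N /\ (i + j = 2 * r + e)%N.
    by exists (i + j)./2, (odd (i + j)); split; lia.
  have e01 : e = 0%N \/ e = 1%N by lia.
  (* For [j < i] the replacement costs at most [(r + 1) * c 0], and [r + 1 <= i]. *)
  case: (ltnP j i) => ji.
    case: e01 er => {e e1} -> er.
      right; exists (r - 1)%N, 1%N; split; first by lia.
      have : (r - 1 + 2)%:R <= i%:R :> R by rewrite ler_nat; lia.
      rewrite natrD.
      by have : 0 <= (r - 1)%:R :> R by []; nra.
    right; exists r, 0%N; split; first by lia.
    have : (r + 1)%:R <= i%:R :> R by rewrite ler_nat; lia.
    rewrite natrD.
    by have : 0 <= r%:R :> R by []; nra.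
  case: e01 er => {e e1} -> er.
    right; exists (r - 1)%N, 1%N; split; first by lia.
    (* The remaining inequality amounts to [(i - 2)(j - i) >= 0]. *)
    by have := average 1%N 1%N (r - 1)%N; rewrite mul1r addrC; apply; nia.
  case: (leqP (2 * i) j) => ij.
    right; exists (r - 1)%N, 2%N; split; first by lia.
    by have := average 2%N 1%N (r - 1)%N; rewrite mul1r addrC; apply; nia.
  left; exists (r - 2)%N, 2%N; split; [by []|lia|].
  have := average 1%N 2%N (r - 2)%N; rewrite addrC; apply; [lia|lia|].
  (* This is [i(i - 5) <= j(i - 4)]: the coefficient of [j] changes sign at 4, so [i = 2, 3] need
     [j < 2i] and larger [i] need [i <= j]. *)
  by case: (ltnP i 4%N) => i4; [have [|] : i = 2%N \/ i = 3%N by lia|]; nia.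
right; exists 0%N, j; split; first by lia.
by have := iC j; rewrite ii muln1 mul1r mul0r add0r; apply.
Qed.

(** * The dual norm *)

Lemma dual_norm_ge {R : realType} (Omega : set (R * R)) v w :
  convex_toric Omega -> Omega w -> v.1 * w.1 + v.2 * w.2 <= dual_norm Omega v.
Proof. by move=> hO Ow; have [_] := dual_norm_is_max v hO; apply; exists w. Qed.

Lemma dual_norm_attained {R : realType} (Omega : set (R * R)) v :
  convex_toric Omega ->
  exists2 w, Omega w & dual_norm Omega v = v.1 * w.1 + v.2 * w.2.
Proof. by move=> hO; have [[w Ow wE] _] := dual_norm_is_max v hO; exists w. Qed.

(** Evaluate at a maximizer for [u]; its coordinates are nonnegative, so the pairing is monotone. *)
Lemma ler_scale_dual_norm {R : realType} (Omega : set (R * R)) x u v :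
  convex_toric Omega -> x * u.1 <= v.1 -> x * u.2 <= v.2 ->
  x * dual_norm Omega u <= dual_norm Omega v.
Proof.
move=> hO le1 le2; have [w Ow ->] := dual_norm_attained Omega u hO.
have [/(_ _ Ow) [w1 w2] _ _ _] := hO.
apply: le_trans (dual_norm_ge Omega v w hO Ow).
by rewrite mulrDr !mulrA lerD // ler_wpM2r.
Qed.

Lemma dual_norm_subadditive {R : realType} (Omega : set (R * R)) u v :
  convex_toric Omega ->
  dual_norm Omega (u.1 + v.1, u.2 + v.2) <=
    dual_norm Omega u + dual_norm Omega v.
Proof.
move=> hO; have [w Ow ->] := dual_norm_attained Omega (u.1 + v.1, u.2 + v.2) hO.
have := dual_norm_ge Omega u w hO Ow; have := dual_norm_ge Omega v w hO Ow.
by move=> /=; lra.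
Qed.

(** [(0,y)] is the midpoint of [(x,y)] and its mirror image [(-x,y)] in the symmetrization. *)
Lemma convex_toric_proj_y {R : realType} (Omega : set (R * R)) x y :
  convex_toric Omega -> Omega (x, y) -> Omega (0, y).
Proof.
move=> hO Oxy; have [/(_ _ Oxy) [/= x0 y0] _ _ cO] := hO.
have half0 : 0 <= 2^-1 :> R by lra.
have half1 : 2^-1 <= 1 :> R by lra.
have := cO (x, y) (- x, y) (Itv01 half0 half1).
rewrite !inE /symmetrization /= normrN (ger0_norm x0) (ger0_norm y0).
move=> /(_ Oxy Oxy).
rewrite /conv /= /unstable.onem /GRing.scale /=.
have -> : 2^-1 * x + (1 - 2^-1) * - x = 0 by lra.
have -> : 2^-1 * y + (1 - 2^-1) * y = y by lra.
by rewrite normr0 (ger0_norm y0).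
Qed.

(** Projecting a maximizer for [(0,1)] to the y-axis bounds its norm by [b]; the point [(a,0)]
    bounds the norm of [(1,0)] below by [a]. *)
Lemma dual_norm_units {R : realType} (Omega : set (R * R)) a b :
  convex_toric Omega ->
  Omega (a, 0) -> ubound [set y | Omega (0, y)] b -> b <= a ->
  dual_norm Omega (0, 1) <= dual_norm Omega (1, 0).
Proof.
move=> hO Oa ub ba.
have [[x y] Oxy ->] := dual_norm_attained Omega (0, 1) hO.
have := dual_norm_ge Omega (1, 0) _ hO Oa.
have := ub y (convex_toric_proj_y Omega x y hO Oxy).
by move=> /=; lra.
Qed.

Lemma dual_norm_column_costs {R : realType} (Omega : set (R * R)) :
  convex_toric Omega -> dual_norm Omega (0, 1) <= dual_norm Omega (1, 0) ->
  column_costs (dual_norm Omega (0, 1)) (fun s => dual_norm Omega (1, s%:R)).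
Proof.
move=> hO le_units; split=> // [|s|s].
- have [[x y] Oxy ->] := dual_norm_attained Omega (0, 1) hO.
  by have [/(_ _ Oxy) [/= x0 y0] _ _ _] := hO; lra.
- by apply: ler_scale_dual_norm => //=; lra.
- have := dual_norm_subadditive Omega (1, s%:R) (0, 1) hO.
  by rewrite /= addr0 natr1.
Qed.

(** * Reducing an admissible tuple *)

Definition weight (v : nat * nat) : nat := (v.1 + v.2 + 1)%N.

Definition nat_norm {R : realType} (Omega : set (R * R)) (v : nat * nat) : R :=
  dual_norm Omega (v.1%:R, v.2%:R).

Definition omega_bound {R : realType} (Omega : set (R * R)) : nat -> R -> Prop :=
  reduced_bound (dual_norm Omega (0, 1)) (fun s => dual_norm Omega (1, s%:R)).

Lemma reduced_bound_nat_norm {R : realType} (Omega : set (R * R)) v :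
  convex_toric Omega -> dual_norm Omega (0, 1) <= dual_norm Omega (1, 0) ->
  v.1 <> 0%N -> omega_bound Omega (weight v) (nat_norm Omega v).
Proof.
case: v => i j hO le_units /= i0; rewrite /weight /nat_norm /=.
apply: reduced_bound_vector.
- exact: dual_norm_column_costs.
- by lia.
- move=> s sij; apply: ler_scale_dual_norm => //=; first by rewrite mulr1.
  by rewrite -natrM ler_nat mulnC.
- by apply: ler_scale_dual_norm => //=; rewrite ?mulr0 ?mulr1.
Qed.

Lemma reduced_bound_add {R : realType} (b : R) (c : nat -> R) W C W' C' :
  column_costs b c -> reduced_bound b c W C -> reduced_bound b c W' C' ->
  reduced_bound b c (W + W') (C + C').
Proof.
move=> cc rW [[i [j [_ -> le_C']]]|[i [s [-> le_C']]]].
  have {}rW := reduced_bound_add_units b c W C i rW.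
  (* Passing to the exact cost lets the copies of [(1,1)] be added one by one, by induction from
     [j = 0]. *)
  apply: (@reduced_bound_le _ _ _ _ (C + i%:R * b + j%:R * c 1%N)).
    by rewrite -addrA lerD2l.
  elim: j {le_C'} => [|j IHj]; first by rewrite mul0r addr0 muln0 addn0.
  have := reduced_bound_add_column b c _ _ 1%N cc IHj.
  rewrite -addrA -natr1 mulrDl mul1r.
  by have -> : (W + (2 * i + 3 * j) + 1 + 2 = W + (2 * i + 3 * j.+1))%N by lia.
have := reduced_bound_add_column b c _ _ s cc
  (reduced_bound_add_units b c W C i rW).
rewrite -addrA -!addnA; apply: reduced_bound_le.
by rewrite lerD2l.
Qed.

Lemma omega_bound_cat {R : realType} (Omega : set (R * R)) W C t :
  convex_toric Omega -> dual_norm Omega (0, 1) <= dual_norm Omega (1, 0) ->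
  (forall v, v \in t -> v <> (0, 0)%N) -> omega_bound Omega W C ->
  omega_bound Omega (W + \sum_(v <- t) weight v) (C + cost Omega t).
Proof.
move=> hO le_units; rewrite /cost.
elim: t W C => [|v t IHt] W C t0 rW; first by rewrite !big_nil addn0 addr0.
rewrite !big_cons addnA addrA; apply: IHt => [u ut|].
  by apply: t0; rewrite inE ut orbT.
have cc := dual_norm_column_costs Omega hO le_units.
have [v1|/eqP v1] := eqVneq v.1 0%N; last first.
  exact/reduced_bound_add/reduced_bound_nat_norm.
have v2 : (1 <= v.2)%N.
  by move: v1 (t0 v (mem_head _ _)); case: v {t0} => i [|j] //= ->.
have := reduced_bound_add_vertical _ _ _ _ v.2 cc v2 rW.
rewrite /weight v1 add0n addnA; apply: reduced_bound_le.
by rewrite lerD2l; apply: ler_scale_dual_norm => //=; rewrite ?mulr0 ?mulr1.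
Qed.

Lemma sum_weight (t : seq (nat * nat)) :
  (\sum_(v <- t) weight v = \sum_(v <- t) (v.1 + v.2) + size t)%N.
Proof. by rewrite big_split /= sum1_size. Qed.

(** A vector with positive first coordinate starts the reduction, since vertical ones can only be
    absorbed into an existing bound. If there is none, admissibility forces length 1. *)
Lemma admissible_omega_bound {R : realType} (Omega : set (R * R)) k t :
  convex_toric Omega -> dual_norm Omega (0, 1) <= dual_norm Omega (1, 0) ->
  admissible k t -> t = [:: (0, k)%N] \/ omega_bound Omega k.+1 (cost Omega t).
Proof.
move=> hO le_units [t1 t0 tk t2].
have [/hasP[v vt /eqP v1]|] := boolP (has (fun v => v.1 != 0%N) t).
  right; have tE := perm_to_rem vt.
  have -> : k.+1 = (\sum_(v <- t) weight v)%N by rewrite sum_weight; lia.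
  rewrite /cost (perm_big _ tE) [X in omega_bound _ _ X](perm_big _ tE) /=.
  rewrite !big_cons; apply: omega_bound_cat => //.
    by move=> u /mem_rem /t0.
  exact: reduced_bound_nat_norm.
move=> /hasPn t_v; left.
have st : size t = 1%N.
  apply/eqP; rewrite eqn_leq t1 andbT leqNgt; apply/negP => /t2[[v vt]].
  by move/t_v: vt; case: eqP.
case: t st t_v tk {t1 t0 t2} => [|[i j] [|]] //= _ t_v.
have := t_v _ (mem_head _ _); rewrite negbK => /eqP /= ->.
by rewrite big_seq1 addn0 => <-.
Qed.

(** * The finite family of candidates *)

Lemma admissible_cat_units k i (s : seq (nat * nat)) :
  (1 <= size s)%N -> (forall v, v \in s -> v.1 <> 0%N) ->
  [\/ (i + size s <= 1)%N, (1 <= i)%N | exists2 v, v \in s & v.2 <> 0%N] ->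
  (2 * i + \sum_(v <- s) weight v)%N = k.+1 ->
  admissible k (nseq i (0, 1)%N ++ s).
Proof.
move=> s1 s_v s2 sk; rewrite /admissible size_cat size_nseq; split.
- by lia.
- move=> v; rewrite mem_cat mem_nseq => /orP[/andP[_ /eqP ->] //|/s_v v1 v0].
  by apply: v1; rewrite v0.
- move: sk; rewrite sum_weight big_cat big_nseq /= iter_addn_0 add0n.
  by lia.
- move=> is2; split.
    case: s s1 s_v {s2 sk is2} => // v s _ s_v; exists v; last first.
      by apply: s_v; exact: mem_head.
    by rewrite mem_cat mem_head orbT.
  case: s2 => [|i1|[v vs v2]]; first by lia.
    by exists (0, 1)%N => //; rewrite mem_cat mem_nseq i1 eqxx.
  by exists v => //; rewrite mem_cat vs orbT.
Qed.

Lemma cost_cat_units {R : realType} (Omega : set (R * R)) i s :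
  cost Omega (nseq i (0, 1)%N ++ s) =
    i%:R * dual_norm Omega (0, 1) + cost Omega s.
Proof. by rewrite /cost big_cat big_nseq /= iter_addr_0 mulr_natl. Qed.

Definition listed_form (s : seq (nat * nat)) : Prop :=
  [\/ exists i j : nat,
        (1 <= j)%N /\ s = nseq i (0, 1)%N ++ nseq j (1, 1)%N,
      exists i t : nat,
        (2 <= t)%N /\ s = nseq i (0, 1)%N ++ [:: (1, t)%N],
      exists i : nat,
        (1 <= i)%N /\ s = nseq i (0, 1)%N ++ [:: (1, 0)%N] |
      exists t : nat,
        (1 <= t)%N /\ s = [:: (0, t)%N]].

(** Codes from a finite type, so that a minimum exists; indices up to [k + 1] suffice for weight
    [k + 1]. Codes of the wrong weight or form are discarded by [good_shape]. *)
Definition shape k (x : option (bool * 'I_k.+2 * 'I_k.+2)) : seq (nat * nat) :=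
  if x is Some (diag, i, j) then
    nseq i (0, 1)%N ++ (if diag then nseq j (1, 1)%N else [:: (1, j : nat)%N])
  else [:: (0, k)%N].

Definition good_shape k (x : option (bool * 'I_k.+2 * 'I_k.+2)) : Prop :=
  admissible k (shape k x) /\ listed_form (shape k x).

Lemma good_shape_None k : (1 <= k)%N -> good_shape k None.
Proof.
move=> k1; split; last by constructor 4; exists k.
split=> //= [v|]; last by rewrite big_seq1 addn0.
by rewrite inE => /eqP -> [k0]; rewrite k0 in k1.
Qed.

Lemma omega_bound_good_shape {R : realType} (Omega : set (R * R)) k C :
  (1 <= k)%N -> dual_norm Omega (0, 1) <= dual_norm Omega (1, 0) ->
  omega_bound Omega k.+1 C ->
  exists2 x, good_shape k x & cost Omega (shape k x) <= C.
Proof.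
move=> k1 le_units [[i [j [j2 kE le_C]]]|[i [s [kE le_C]]]].
  have [ik jk] : (i < k.+2)%N /\ (j < k.+2)%N by lia.
  exists (Some (true, Ordinal ik, Ordinal jk)) => /=; last first.
    rewrite cost_cat_units /cost big_nseq iter_addr_0 -[X in _ + X]mulr_natl.
    exact: le_C.
  split; last by constructor 1; exists i, j; split; first by lia.
  apply: (admissible_cat_units k i (nseq j (1, 1)%N)); rewrite ?size_nseq.
  - by lia.
  - by move=> v; rewrite mem_nseq => /andP[_ /eqP ->].
  - by constructor 3; exists (1, 1)%N => //; rewrite mem_nseq eqxx andbT; lia.
  - by rewrite big_nseq iter_addn_0 kE.
have [ik sk] : (i < k.+2)%N /\ (s < k.+2)%N by lia.
(* [(1,0)] alone, where [k = 1], is not a listed form; [(0,1)] replaces it at no larger cost. *)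
have [is0|is0] : i = 0%N /\ s = 0%N \/ (1 <= i + s)%N by lia.
  exists None; first exact: good_shape_None.
  have -> : k = 1%N by lia.
  move: le_C; case: is0 => -> ->; rewrite mul0r add0r /= /cost big_seq1.
  exact: le_trans.
exists (Some (false, Ordinal ik, Ordinal sk)) => /=; last first.
  by rewrite cost_cat_units /cost big_seq1.
split.
  apply: (admissible_cat_units k i [:: (1, s)%N]) => //.
  - by move=> v; rewrite inE => /eqP ->.
  - have [s0|s0] := posnP s; first by constructor 2; lia.
    by constructor 3; exists (1, s)%N; [exact: mem_head|move=> /= ?; lia].
  - by rewrite big_seq1 kE /weight /=; lia.
rewrite /shape /=.
case: s {sk le_C kE} is0 => [|[|s]] is0 /=.
- by constructor 3; exists i; split=> //; lia.
- by constructor 1; exists i, 1%N.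
- by constructor 2; exists i, s.+2.
Qed.

Theorem corollary1p3p1 (R : realType) (Omega : set (R * R)) (a b : R) (k : nat)
    (hOmega : convex_toric Omega)
    (hk : (1 <= k)%N)
    (ha : is_max [set x : R | Omega (x, 0)] a)
    (hb : is_max [set y : R | Omega (0, y)] b)
    (hab : b <= a) :
  exists2 s : seq (nat * nat), minimizer Omega k s &
    [\/ exists i j : nat,
          (1 <= j)%N /\ s = nseq i (0, 1)%N ++ nseq j (1, 1)%N,
        exists i t : nat,
          (2 <= t)%N /\ s = nseq i (0, 1)%N ++ [:: (1, t)%N],
        exists i : nat,
          (1 <= i)%N /\ s = nseq i (0, 1)%N ++ [:: (1, 0)%N] |
        exists t : nat,
          (1 <= t)%N /\ s = [:: (0, t)%N]].
Proof.
have le_units : dual_norm Omega (0, 1) <= dual_norm Omega (1, 0).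
  by apply: (dual_norm_units Omega a b) => //; [case: ha|case: hb].
pose P x := `[< good_shape k x >].
have good0 : P None by apply/asboolP; exact: good_shape_None.
case: (@Order.TotalTheory.arg_minP _ R _ None P
         (fun x => cost Omega (shape k x)) good0) => x.
move=> /asboolP[adm_x form_x] min_x.
exists (shape k x); last exact: form_x.
split=> // t adm_t.
(* Any competitor is [shape k None] or costs at least as much as some good shape. *)
have [->|bnd] := admissible_omega_bound Omega k t hOmega le_units adm_t.
  exact: min_x good0.
have [y /asboolP good_y] := omega_bound_good_shape Omega k _ hk le_units bnd.
exact/le_trans/min_x.
Qed.
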